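(* Let $\{\mathcal{D}_M\}_{M\in\mathbb{N}}$ be a sequence of partitions $\mathcal{D}_M=\{0=t_0<\cdots<t_M=1\}$ of $[0,1]$ with $|\mathcal{D}_M|\to0$ as $M\to\infty$. Assume the activation function $\varphi:\mathbb{R}\to\mathbb{R}$ is Lipschitz and linearly bounded. Let $x\in\mathbb{X}$, fix $N\ge1$ and let $\rho_M(t):=\sup\{s\in\mathcal{D}_M:s\le t\}$. Then the $\mathbb{R}^N$-valued process $t\mapsto S^{M,N}_{\rho_M(t)}(x)$ converges in distribution (as random variables with values in $L^\infty([0,1];\mathbb{R}^N)$), as $M\to\infty$, to the solution $S^N(x)$ of the Neural CDE $$dS^N_t(x)=\sum_{j=1}^d\big(A_j\varphi(S^N_t(x))+b_j\big)\,dx^j_t,\qquad S^N_0(x)=a,$$ where $a\in\mathbb{R}^N$, $A_j\in\mathbb{R}^{N\times N}$ and $b_j\in\mathbb{R}^N$ are sampled as in the definition of the homogeneous controlled ResNet.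
   Context: $\mathbb{X}=\{x\in C^0([0,1];\mathbb{R}^d): x(0)=0,\ \exists\,\dot x\in L^2([0,1];\mathbb{R}^d)\}$; $|\mathcal{D}|=\max_i|t_i-t_{i-1}|$. $\varphi$ is linearly bounded if $|\varphi(u)|\le C(1+|u|)$ for some $C>0$; it acts componentwise on vectors. Parameters $\sigma_a,\sigma_A>0$, $\sigma_b\ge0$. The hidden state of the homogeneous controlled ResNet is defined on $\mathcal{D}_M$ by $$S^{M,N}_{t_{i+1}}(x)=S^{M,N}_{t_i}(x)+\sum_{k=1}^d\big(A_k\varphi(S^{M,N}_{t_i}(x))+b_k\big)(x^k_{t_{i+1}}-x^k_{t_i}),\qquad S^{M,N}_{t_0}(x)=a,$$ with independent entries $[a]_\alpha\sim\mathcal{N}(0,\sigma_a^2)$, $[A_k]_\alpha^\beta\sim\mathcal{N}(0,\frac{\sigma_A^2}{N})$, $[b_k]_\alpha\sim\mathcal{N}(0,\sigma_b^2)$. *)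

(* Defs.v *)
From HB Require Import structures.
From mathcomp Require Import all_boot all_order all_algebra.
From mathcomp Require Import all_classical all_reals all_analysis.
From mathcomp Require Import ess_sup_inf.

Set Implicit Arguments.
Unset Strict Implicit.
Unset Printing Implicit Defensive.

Import Order.TTheory GRing.Theory Num.Theory.
Import numFieldNormedType.Exports.

Local Open Scope classical_set_scope.
Local Open Scope ring_scope.

Definition leb01 (R : realType) : {measure set (g_sigma_algebraType R.-ocitv.-measurable) -> \bar R} :=
  mrestr (@lebesgue_measure R) (measurable_itv `[0%R, 1%R]).

(** R^N is ['cV[R]_N], whose library norm is the maximum norm. *)

Definition Linf_fun (R : realType) (N : nat) (f : R -> 'cV[R]_N) : Prop :=
  (forall i, @measurable_fun _ _ (measurableTypeR R) (measurableTypeR R)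
     `[0, 1] (fun t => f t i ord0)) /\
  (ess_sup (leb01 R) (fun t => `|f t|%:E) < +oo)%E.

Record LinfFun (R : realType) (N : nat) := MkLinfFun {
  linf_val :> R -> 'cV[R]_N ;
  linf_valP : Linf_fun linf_val }.

HB.instance Definition _ (R : realType) N := gen_eqMixin (LinfFun R N).
HB.instance Definition _ (R : realType) N := gen_choiceMixin (LinfFun R N).

Section Linf.
Context {R : realType} {N : nat}.
Local Notation mu := (leb01 R).

Lemma ae01W (Q : R -> Prop) : (forall t, Q t) -> \forall t \ae mu, Q t.
Proof. exact: (@nearW _ _ _ (ae_filter_ringOfSetsType mu)). Qed.

Lemma ae01S (Q Q' : R -> Prop) : (forall t, Q t -> Q' t) ->
  (\forall t \ae mu, Q t) -> \forall t \ae mu, Q' t.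
Proof. exact: (@filterS _ _ (ae_filter_ringOfSetsType mu)). Qed.

Lemma ae01S2 (Q Q' Q'' : R -> Prop) : (forall t, Q t -> Q' t -> Q'' t) ->
  (\forall t \ae mu, Q t) -> (\forall t \ae mu, Q' t) ->
  \forall t \ae mu, Q'' t.
Proof. exact: (@filterS2 _ _ (ae_filter_ringOfSetsType mu)). Qed.

Implicit Types f g h : LinfFun R N.

Definition linf_eq f g : bool := `[< \forall t \ae mu, f t = g t >].

Let linf_eq_refl : reflexive linf_eq.
Proof. by move=> f; apply/asboolP; exact: ae01W. Qed.

Let linf_eq_sym : symmetric linf_eq.
Proof.
move=> f g; apply/idP/idP => /asboolP fg; apply/asboolP.
  by apply: ae01S fg => t ->.
by apply: ae01S fg => t ->.
Qed.

Let linf_eq_trans : transitive linf_eq.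
Proof.
move=> g f h /asboolP fg /asboolP gh; apply/asboolP.
by apply: ae01S2 fg gh => t -> ->.
Qed.

Canonical linf_eq_equiv :=
  EquivRel linf_eq linf_eq_refl linf_eq_sym linf_eq_trans.

Definition Linf : Type := {eq_quot linf_eq}%qT.
HB.instance Definition _ := Choice.on Linf.
HB.instance Definition _ := EqQuotient.on Linf.

Lemma Linf_fun0 : Linf_fun (fun=> 0 : 'cV[R]_N).
Proof.
split=> [i|]; first exact: measurable_cst.
apply: (@le_lt_trans _ _ 0%E); last exact: ltry.
by apply/ess_supP; apply: ae01W => t; rewrite normr0.
Qed.

(** The class of an essentially bounded function, and a dummy value on the
    other functions. *)
Definition Linf_class (f : R -> 'cV[R]_N) : Linf :=
  match pselect (Linf_fun f) with
  | left fP => \pi_Linf%qT (MkLinfFun fP)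
  | right _ => \pi_Linf%qT (MkLinfFun Linf_fun0)
  end.

Lemma Linf_classP (f : R -> 'cV[R]_N) : Linf_fun f ->
  \forall t \ae mu, (repr (Linf_class f) : LinfFun R N) t = f t.
Proof.
move=> fP; rewrite /Linf_class; case: pselect => // fP'.
case: piP => g /eqP; rewrite eqmodE => /asboolP.
exact: ae01S.
Qed.

HB.instance Definition _ := isPointed.Build Linf (Linf_class (fun=> 0)).

Definition linf_repr (u : Linf) : LinfFun R N := repr u.

Definition Linf_dist (u v : Linf) : R :=
  fine (ess_sup mu (fun t => `|linf_repr u t - linf_repr v t|%:E)).

Let mu_gt0 : (0 < mu setT)%E.
Proof.
by rewrite /leb01 /= /mrestr setTI lebesgue_measure_itv /= lte01 oppr0 adde0 lte01.
Qed.

Let ess_fin f g :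
  ess_sup mu (fun t => `|f t - g t|%:E) \is a fin_num.
Proof.
rewrite fin_numElt; apply/andP; split.
  apply: (@lt_le_trans _ _ 0%E); first exact: ltNy0.
  by apply: ess_sup_gee => //; apply: ae01W => t; rewrite lee_fin.
have [[_ fM] [_ gM]] := (linf_valP f, linf_valP g).
apply: le_lt_trans (lte_add_pinfty fM gM).
apply/ess_supP; apply: ae01S2 (ess_sup_ge mu (fun t => `|f t|%:E))
  (ess_sup_ge mu (fun t => `|g t|%:E)) => t ft gt.
by apply: (le_trans _ (leeD ft gt)); rewrite -EFinD lee_fin ler_normB.
Qed.

Let Linf_distxx u : Linf_dist u u = 0.
Proof.
rewrite /Linf_dist (@ess_sup_ae_cst _ _ _ _ _ 0%E)//.
by apply: ae01W => t; rewrite subrr normr0.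
Qed.

Let Linf_dist_positivity u v : Linf_dist u v = 0 -> u = v.
Proof.
move=> uv; have := fineK (ess_fin (linf_repr u) (linf_repr v)).
rewrite -/(Linf_dist u v) uv => uv0.
rewrite -[u]reprK -[v]reprK; apply/eqP; rewrite eqmodE; apply/asboolP.
have := ess_sup_ge mu (fun t => `|linf_repr u t - linf_repr v t|%:E).
apply: ae01S => t; rewrite -uv0 lee_fin normr_le0 subr_eq0.
by move/eqP.
Qed.

Let Linf_dist_sym u v : Linf_dist u v = Linf_dist v u.
Proof.
by congr fine; apply: eq_ess_sup; apply: ae01W => t; rewrite distrC.
Qed.

Let Linf_dist_triangle v u w : Linf_dist u w <= Linf_dist u v + Linf_dist v w.
Proof.
rewrite -lee_fin EFinD /Linf_dist !fineK//.
apply/ess_supP.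
apply: ae01S2
  (ess_sup_ge mu (fun t => `|linf_repr u t - linf_repr v t|%:E))
  (ess_sup_ge mu (fun t => `|linf_repr v t - linf_repr w t|%:E)) => t uv vw.
by apply: (le_trans _ (leeD uv vw)); rewrite -EFinD lee_fin ler_distD.
Qed.

HB.instance Definition _ := isMetric.Build R Linf
  Linf_distxx Linf_dist_positivity Linf_dist_sym Linf_dist_triangle.

End Linf.
Arguments Linf : clear implicits.

Section Distribution.
Context {R : realType} {disp : measure_display} {T : measurableType disp}.
Variable P : probability T R.

Definition borel_measurable (E : ptopologicalType) (X : T -> E) : Prop :=
  measurable_fun [set: T] (X : T -> g_sigma_algebraType (@open E)).

Definition cvg_in_distribution (E : ptopologicalType)
    (X_ : nat -> T -> E) (X : T -> E) : Prop :=
  [/\ forall n, borel_measurable (X_ n), borel_measurable X &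
    forall f : E -> R, continuous f -> bounded_fun f ->
      ('E_P[f \o X_ n] @[n --> \oo] --> 'E_P[f \o X])%E].

Definition cvg_in_distribution_Linf (N : nat)
    (X_ : nat -> T -> R -> 'cV[R]_N) (X : T -> R -> 'cV[R]_N) : Prop :=
  [/\ forall n w, Linf_fun (X_ n w), forall w, Linf_fun (X w) &
    @cvg_in_distribution (Linf R N)
      (fun n w => Linf_class (X_ n w)) (fun w => Linf_class (X w))].

Definition mutually_independent (I : finType) (X : I -> T -> R) : Prop :=
  forall (J : {set I}) (B : I -> set R), (forall i, measurable (B i)) ->
    P (\bigcap_(i in [set i | i \in J]) (X i @^-1` B i)) =
    (\big[*%E/1%E]_(i in J) P (X i @^-1` B i))%E.

End Distribution.

(** The normal law of mean [m] and variance [v]; the library's [normal_prob]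
    takes the standard deviation and is not the Dirac mass when it is [0]. *)
Definition gaussian (R : realType) (m v : R) : set (measurableTypeR R) -> \bar R :=
  if v == 0 then \d_m else normal_prob m (Num.sqrt v).

Section Weights.
Context {R : realType} {disp : measure_display} {T : measurableType disp}.
Variables (P : probability T R) (N d : nat).
Variables (a : T -> 'cV[R]_N) (A : 'I_d -> T -> 'M[R]_N) (b : 'I_d -> T -> 'cV[R]_N).

Definition weight_index : Type := ('I_N + 'I_d * 'I_N * 'I_N + 'I_d * 'I_N)%type.
HB.instance Definition _ := Finite.on weight_index.

Definition weight (j : weight_index) (w : T) : R :=
  match j with
  | inl (inl i) => a w i ord0
  | inl (inr (k, i, l)) => A k w i l
  | inr (k, i) => b k w i ord0
  end.

Definition weight_variance (sigma_a sigma_A sigma_b : R) (j : weight_index) : R :=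
  match j with
  | inl (inl _) => sigma_a ^+ 2
  | inl (inr _) => sigma_A ^+ 2 / N%:R
  | inr _ => sigma_b ^+ 2
  end.

Definition gaussian_weights (sigma_a sigma_A sigma_b : R) : Prop :=
  [/\ forall j, measurable_fun [set: T] (weight j),
      forall j (B : set (measurableTypeR R)), measurable B ->
        P (weight j @^-1` B) =
        gaussian 0 (weight_variance sigma_a sigma_A sigma_b j) B &
      mutually_independent P weight].

End Weights.

Section Paths.
Context {R : realType} {d : nat}.
Implicit Types x v : R -> 'cV[R]_d.

(** [v] is an L^2 (weak) derivative of [x] on [0,1]. *)
Definition L2_derivative x v : Prop :=
  (forall k, (fun s => v s k ord0) \in Lfun (leb01 R) 2%:E) /\
  (forall t, t \in `[0, 1] -> forall k,
     x t k ord0 - x 0 k ord0 = \int[lebesgue_measure]_(s in `[0, t]) v s k ord0).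

Definition path_space : set (R -> 'cV[R]_d) :=
  [set x : R -> 'cV[R]_d | [/\ {within `[0 : R, 1 : R], continuous x}, x 0 = 0 &
               exists v, L2_derivative x v]].

(** A version of the derivative (unique up to a null set) of a path of
    [path_space]. *)
Definition dot x : R -> 'cV[R]_d := xget (fun=> 0) [set v | L2_derivative x v].

End Paths.

Section Dynamics.
Context {R : realType} {N d : nat}.
Variables (phi : R -> R) (a : 'cV[R]_N) (A : 'I_d -> 'M[R]_N) (b : 'I_d -> 'cV[R]_N).
Variable x : R -> 'cV[R]_d.

Definition vector_field (k : 'I_d) (y : 'cV[R]_N) : 'cV[R]_N :=
  A k *m map_mx phi y + b k.

Fixpoint resnet (t : nat -> R) (i : nat) : 'cV[R]_N :=
  if i is j.+1 then
    resnet t j + \sum_(k < d)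
      (x (t j.+1) k ord0 - x (t j) k ord0) *: vector_field k (resnet t j)
  else a.

Definition ncde_solution (y : R -> 'cV[R]_N) : Prop :=
  {within `[0 : R, 1 : R], continuous y} /\
  forall t, t \in `[0, 1] -> forall i,
    y t i ord0 = a i ord0 + \sum_(k < d)
      \int[lebesgue_measure]_(s in `[0, t])
        (vector_field k (y s) i ord0 * dot x s k ord0).

End Dynamics.

(** A partition [0 = t_0 < ... < t_M = 1] is given, as in [itv_partition], by
    the sequence [s = [:: t_1; ...; t_M]]. *)
Section Partitions.
Context {R : realType}.
Implicit Type s : seq R.

Definition knots s : seq R := 0 :: s.

Definition mesh s : R :=
  \big[Num.max/0]_(i < size s) `|nth 0 (knots s) i.+1 - nth 0 (knots s) i|.

Definition rho s (t : R) : R := sup [set r | r \in knots s /\ r <= t].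

End Partitions.

Definition resnet_path (R : realType) (N d : nat) (phi : R -> R) (a : 'cV[R]_N)
    (A : 'I_d -> 'M[R]_N) (b : 'I_d -> 'cV[R]_N) (x : R -> 'cV[R]_d)
    (s : seq R) (t : R) : 'cV[R]_N :=
  resnet phi a A b x (nth 0 (knots s)) (index (rho s t) (knots s)).

Definition linearly_bounded (R : realType) (phi : R -> R) : Prop :=
  exists2 C, 0 < C & forall u, `|phi u| <= C * (1 + `|u|).

(* Main.v *)
Require Import Defs.
From mathcomp Require Import all_boot all_order all_algebra.
From mathcomp Require Import all_classical all_reals all_analysis.
From mathcomp Require Import ess_sup_inf measurable_realfun lra.

(** Convergence holds for every outcome, not just in law. Fix the weights, put
    [W k y = A k *m phi y + b k] and let [v] be the derivative of the path [x]. The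
    network on a partition is the Euler scheme of the controlled equation: its
    piecewise constant path [Z] satisfies the integral equation
    [Z t = a + \sum_k \int_0^t W k (Z s) v_k(s) ds] up to a defect [delta], which is
    at most a constant times the largest variation of [x] between two times that
    are at most the mesh apart ([resnet_approximate]). The constant is uniform in the
    partition by a discrete Gronwall bound on the states ([resnet_bound]), and the
    variation tends to 0 with the mesh by absolute continuity of the integral of
    [|v|] ([control_variation_modulus]).

    Two approximate solutions with defects [delta] and [delta'] are uniformly
    within [K (delta + delta')] of each other, where [K] depends only on the
    Lipschitz constant of [W] and on [v] ([approximate_solution_stable], a Gronwall
    argument). This gives everything pathwise: exact solutions are unique; the
    networks form a Cauchy sequence, and their uniform limit is a solution
    ([approximate_solution_limit]), so that no fixed point theorem is needed; and
    the networks converge to the solution in [L^oo] ([resnet_cvg]).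

    What remains is Borel measurability in the non-separable space [L^oo]. For a
    fixed partition the network is the image of a measurable random matrix, its
    states at the knots, under a continuous map ([borel_measurable_step]). The
    solution is a pointwise limit of such maps, and pointwise limits of Borel maps
    into a metric space are Borel ([borel_measurable_limit]). Convergence in
    distribution then follows by dominated convergence
    ([cvg_in_distribution_pointwise]). *)

Set Implicit Arguments.
Unset Strict Implicit.
Unset Printing Implicit Defensive.

Import Order.TTheory GRing.Theory Num.Theory.
Import numFieldNormedType.Exports.

Local Open Scope classical_set_scope.
Local Open Scope ring_scope.

(** * Norms of matrices and drifts along an integrable control *)

Section ColumnNorm.
Context {R : realType}.

Lemma mx_entry_le m n (y : 'M[R]_(m, n)) i j : `|y i j| <= `|y|.
Proof.
by rewrite [leRHS]/Num.Def.normr/= mx_normrE; apply: (le_bigmax _ _ (i, j)).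
Qed.

Lemma mx_norm_le m n (y : 'M[R]_(m, n)) c :
  0 <= c -> (forall i j, `|y i j| <= c) -> `|y| <= c.
Proof.
move=> c0 yc; rewrite [leLHS]/Num.Def.normr/= mx_normrE.
by apply/bigmax_leP; split => // -[i j] _ /=.
Qed.

Lemma cV_norm_le n (y : 'cV[R]_n) c :
  0 <= c -> (forall i, `|y i ord0| <= c) -> `|y| <= c.
Proof. by move=> c0 yc; apply: mx_norm_le => // i j; rewrite [j]ord1. Qed.

End ColumnNorm.

Section Drift.
Context {R : realType} {N d : nat}.
Implicit Types (v : R -> 'cV[R]_d) (U : 'I_d -> R -> 'cV[R]_N).
Local Notation mu := (@lebesgue_measure R).

Definition integrable_control v :=
  forall k, mu.-integrable `[0, 1] (EFin \o (fun s => v s k ord0)).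

(** When [v] is the derivative of a path, this is the total variation on [[0, t]]
    of its components, added up: the clock by which every error below is
    measured. *)
Definition control_variation v (t : R) : R :=
  \sum_(k < d) \int[mu]_(s in `[0, t]) `|v s k ord0|.

(** These functions can be integrated against an integrable control. The bound is
    required at every point, and not only almost everywhere, because approximate
    solutions are compared pointwise. *)
Definition admissible n (Z : R -> 'cV[R]_n) :=
  (forall i, @measurable_fun _ _ (measurableTypeR R) (measurableTypeR R)
     `[0, 1] (fun t => Z t i ord0)) /\
  exists B, forall t, t \in `[0, 1] -> `|Z t| <= B.

Definition drift v U (t : R) : 'cV[R]_N :=
  \col_i \sum_(k < d) \int[mu]_(s in `[0, t]) (U k s i ord0 * v s k ord0).

Lemma itv0S (t : R) : t <= 1 -> `[0, t] `<=` (`[0, 1] : set R).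
Proof. by move=> t1; apply: subset_itvl; rewrite bnd_simp. Qed.

Lemma itvooS (s t : R) : 0 <= s -> t <= 1 -> `]s, t[ `<=` (`[0, 1] : set R).
Proof. by move=> s0 t1; apply: subset_itv; rewrite bnd_simp. Qed.

Lemma admissible_integrable v U k i : integrable_control v -> admissible (U k) ->
  mu.-integrable `[0, 1] (EFin \o (fun s => U k s i ord0 * v s k ord0)).
Proof.
move=> vI [Um [B UB]].
have := @integrableMr _ _ _ mu `[0, 1]%classic (measurable_itv _)
  (fun s => U k s i ord0) _ (Um i) _ (vI k).
apply.
exists B; split; first exact: num_real.
move=> c Bc t t01 /=.
by rewrite (le_trans (mx_entry_le _ _ _))// (le_trans (UB _ _))// ltW.
Qed.

(** The open interval matters: a step function equals its value at a knot on the
    open interval that follows, but no longer at the next knot. *)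
Lemma Rintegral_increment (f : R -> R) (s t : R) : 0 <= s -> s <= t -> t <= 1 ->
  mu.-integrable `[0, 1] (EFin \o f) ->
  \int[mu]_(r in `[0, t]) f r - \int[mu]_(r in `[0, s]) f r =
  \int[mu]_(r in `]s, t[) f r.
Proof.
move=> s0 st t1 fI; rewrite Rintegral_itvB ?bnd_simp//; last first.
  by apply: integrableS fI => //; exact: itv0S.
rewrite Rintegral_itv_bndo_bndc//.
by apply: integrableS fI => //; exact: itvooS.
Qed.

Lemma control_variationB v (s t : R) :
  integrable_control v -> 0 <= s -> s <= t -> t <= 1 ->
  control_variation v t - control_variation v s =
  \sum_(k < d) \int[mu]_(r in `]s, t[) `|v r k ord0|.
Proof.
move=> vI s0 st t1; rewrite -sumrB; apply: eq_bigr => k _.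
rewrite Rintegral_increment//.
exact: (integrable_norm (vI k)).
Qed.

Lemma control_variation_ge0 v t : 0 <= control_variation v t.
Proof. by apply: sumr_ge0 => k _; apply: Rintegral_ge0. Qed.

Lemma control_variation_homo v (s t : R) :
  integrable_control v -> 0 <= s -> s <= t -> t <= 1 ->
  control_variation v s <= control_variation v t.
Proof.
move=> vI s0 st t1; rewrite -subr_ge0 control_variationB//.
by apply: sumr_ge0 => k _; apply: Rintegral_ge0.
Qed.

(** Absolute continuity of the integral of [|v|]. It replaces both the continuity
    of the variation and its uniformity on [[0, 1]]. *)
Lemma control_variation_modulus v e : integrable_control v -> 0 < e ->
  exists2 eta, 0 < eta & forall s t, 0 <= s -> s <= t -> t <= 1 -> t - s < eta ->
    control_variation v t - control_variation v s <= e.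
Proof.
move=> vI e0.
have h0 : 0 < e / d.+1%:R by rewrite divr_gt0.
have /choice[r rP] : forall k : 'I_d, exists r : R, 0 < r /\
   forall s t, 0 <= s -> s <= t -> t <= 1 -> t - s < r ->
   \int[mu]_(q in `]s, t[) `|v q k ord0| <= e / d.+1%:R.
  move=> k; pose f := (fun s => v s k ord0) \_ `[0, 1].
  have fI : mu.-integrable setT (EFin \o f).
    by rewrite -restrict_EFin; apply/integrable_restrict => //=; rewrite setTI; exact: vI.
  have [r [r0 rP]] := integral_normr_continuous fI h0.
  exists r; split => // s t s0 st t1 ts.
  have small : (mu `]s, t[ < r%:E)%E.
    rewrite lebesgue_measure_itv/= lte_fin.
    by case: ifPn => // _; rewrite -EFinD lte_fin.
  apply/ltW; apply: (le_lt_trans _ (rP `]s, t[%classic (measurable_itv _) small)).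
  rewrite le_eqVlt; apply/orP; left; apply/eqP; apply: eq_Rintegral => q.
  rewrite inE => /(itvooS s0 t1) q01.
  by rewrite /f patchE ifT// inE.
pose eta := \big[Num.min/1]_k r k.
exists eta.
  by apply/bigmin_gtP; split => [|k _]; [exact: ltr01 | case: (rP k)].
move=> s t s0 st t1 ts; rewrite control_variationB//.
apply: (@le_trans _ _ (\sum_(k < d) e / d.+1%:R)).
  apply: ler_sum => k _; apply: (proj2 (rP k)) => //.
  by apply: (lt_le_trans ts); exact: bigmin_le.
rewrite sumr_const card_ord -[_ *+ d]mulr_natr mulrAC ler_pdivrMr//.
by rewrite ler_wpM2l ?ler_nat// ltW.
Qed.

(** All later estimates get their integral bounds from this inequality. With
    [B = 0] it says that the drift increment over [[s, t]] only depends on the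
    integrand on the open interval. *)
Lemma drift_increment v U (s t B : R) : integrable_control v ->
  (forall k, admissible (U k)) -> 0 <= s -> s <= t -> t <= 1 -> 0 <= B ->
  (forall k r, r \in `]s, t[ -> `|U k r| <= B) ->
  `|drift v U t - drift v U s| <= B * (control_variation v t - control_variation v s).
Proof.
move=> vI UA s0 st t1 B0 UB.
have V0 : 0 <= control_variation v t - control_variation v s.
  by rewrite subr_ge0 control_variation_homo.
apply: cV_norm_le => [|i]; first exact: mulr_ge0.
rewrite !mxE -sumrB control_variationB// mulr_sumr (le_trans (ler_norm_sum _ _ _))//.
apply: ler_sum => k _.
have fI := admissible_integrable i vI (UA k).
have sub : `]s, t[ `<=` (`[0, 1] : set R) by exact: itvooS.
have vI' : mu.-integrable `]s, t[ (EFin \o (fun r => `|v r k ord0|)).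
  have vI' : mu.-integrable `]s, t[ (EFin \o (fun r => v r k ord0)).
    by apply: integrableS (vI k).
  exact: (integrable_norm vI').
have fI' : mu.-integrable `]s, t[ (EFin \o (fun r => U k r i ord0 * v r k ord0)).
  exact: integrableS fI.
rewrite Rintegral_increment// (le_trans (le_normr_Rintegral _ _))//.
rewrite -RintegralZl//; apply: le_Rintegral => //.
- exact: (integrable_norm fI').
- have := integrableZl _ B vI'.
  by move=> /(_ (measurable_itv _)); apply: eq_integrable => // r _; rewrite /= EFinM.
move=> r rst; rewrite normrM ler_wpM2r//.
by rewrite (le_trans (mx_entry_le _ _ _))// UB.
Qed.

Lemma driftB v U U' t : integrable_control v ->
  (forall k, admissible (U k)) -> (forall k, admissible (U' k)) -> t \in `[0, 1] ->
  drift v U t - drift v U' t = drift v (fun k r => U k r - U' k r) t.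
Proof.
move=> vI UA UA'; rewrite in_itv/= => /andP[t0 t1].
apply/colP => i; rewrite !mxE -sumrB; apply: eq_bigr => k _.
rewrite -RintegralB//; last 2 first.
- by apply: integrableS (admissible_integrable i vI (UA k)) => //; exact: itv0S.
- by apply: integrableS (admissible_integrable i vI (UA' k)) => //; exact: itv0S.
by apply: eq_Rintegral => r _; rewrite !mxE mulrBl.
Qed.

Lemma admissibleB n (Z Z' : R -> 'cV[R]_n) : admissible Z -> admissible Z' ->
  admissible (fun r => Z r - Z' r).
Proof.
move=> [Zm [B ZB]] [Zm' [B' ZB']]; split.
  move=> i; rewrite (_ : (fun _ => _) = (fun t => Z t i ord0) \- (fun t => Z' t i ord0)).
    exact: (measurable_funB (Zm i) (Zm' i)).
  by apply/funext => t; rewrite !mxE.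
exists (B + B') => t t01.
by rewrite (le_trans (ler_normB _ _))// lerD ?ZB ?ZB'.
Qed.

Lemma admissible_cst n (z : 'cV[R]_n) : admissible (fun=> z).
Proof. by split => [i|]; [exact: measurable_cst | exists `|z|]. Qed.

Lemma drift0 v U : drift v U 0 = 0.
Proof.
apply/colP => i; rewrite !mxE big1// => k _.
by rewrite set_itv1 Rintegral_set1.
Qed.

End Drift.

(** * Stability and limits of approximate solutions *)

Section Stability.
Context {R : realType} {N d : nat}.
Variables (v : R -> 'cV[R]_d) (W : 'I_d -> 'cV[R]_N -> 'cV[R]_N) (a : 'cV[R]_N).
Implicit Types Z : R -> 'cV[R]_N.

(** The last condition makes the field along a path integrable against the
    control. *)
Definition lipschitz_field (L : R) :=
  [/\ 0 <= L, forall k y z, `|W k y - W k z| <= L * `|y - z| &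
      forall k Z, admissible Z -> admissible (fun t => W k (Z t))].

(** The defect is measured in the integral equation, so that a discontinuous step
    function can qualify. With [delta = 0] this is the integral equation itself,
    and one stability estimate then serves for uniqueness, for the Cauchy
    property of the Euler scheme and for its rate of convergence. *)
Definition approximate_solution (delta : R) Z :=
  admissible Z /\ forall t, t \in `[0, 1] ->
    `|Z t - (a + drift v (fun k s => W k (Z s)) t)| <= delta.

Lemma approximate_solution_ge0 delta Z : approximate_solution delta Z -> 0 <= delta.
Proof.
by move=> [_ /(_ 0)]; rewrite bound_itvE ler01 => /(_ isT); exact: le_trans.
Qed.

(** Gronwall's inequality without exponentials. Let [E] be the difference of the
    two drifts, so that [|Z - Z'| <= Delta + |E|] with [Delta = delta + delta'].
    On a subinterval where the control varies by at most [1 / (2 (L + 1))], the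
    supremum [m] of [|E|] satisfies [m <= c + (m + Delta) / 2], where [c] bounds
    [|E|] at the left end, hence [m <= 2 c + Delta]. Going through [n]
    subintervals gives [|E| <= (2 ^ n - 1) Delta], and [n] depends only on [L]
    and on the control. *)
Lemma approximate_solution_stable L : integrable_control v -> lipschitz_field L ->
  exists2 K, 0 <= K & forall delta delta' Z Z',
    approximate_solution delta Z -> approximate_solution delta' Z' ->
    forall t, t \in `[0, 1] -> `|Z t - Z' t| <= K * (delta + delta').
Proof.
move=> vI [L0 WL WA].
have e0 : 0 < (2 * (L + 1))^-1 by rewrite invr_gt0; lra.
have [eta eta0 etaP] := control_variation_modulus vI e0.
pose h := eta / 2; have h0 : 0 < h by rewrite divr_gt0.
pose n := (Num.trunc h^-1).+1.
have nh : 1 <= n%:R * h by rewrite -ler_pdivrMr// mul1r ltW// truncnS_gt.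
exists (2 ^+ n) => [|delta delta' Z Z' Zd Zd']; first exact: exprn_ge0.
have Delta0 := addr_ge0 (approximate_solution_ge0 Zd) (approximate_solution_ge0 Zd').
move: Zd Zd' => [ZA ZE] [ZA' ZE'].
set Delta := delta + delta' in Delta0 *.
have WZA k := WA k _ ZA; have WZA' k := WA k _ ZA'.
pose U k s := W k (Z s) - W k (Z' s).
have UA k : admissible (U k) by exact: admissibleB.
have dist_le t : t \in `[0, 1] -> `|(Z t - Z' t) - drift v U t| <= Delta.
  move=> t01; rewrite -driftB//.
  move: (ZE t t01) (ZE' t t01).
  set D := drift _ _ _; set D' := drift _ _ _ => le1 le2.
  rewrite (_ : _ - _ = (Z t - (a + D)) - (Z' t - (a + D'))); last first.
    rewrite !opprD !opprK !addrA.
    by rewrite [RHS](ACl (1*4*2*5*3*6))/= addrNK.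
  by rewrite (le_trans (ler_normB _ _))// lerD.
have ZZ' t : t \in `[0, 1] -> `|Z t - Z' t| <= Delta + `|drift v U t|.
  move=> t01; rewrite -[X in `|X|](subrK (drift v U t)).
  by rewrite (le_trans (ler_normD _ _))// lerD2r dist_le.
(* Induction over the subintervals of length [h]. *)
have main : forall j t, t \in `[0, 1] -> t <= j%:R * h ->
    `|drift v U t| <= (2 ^+ j - 1) * Delta.
  elim=> [t|j IH t t01 tj].
    rewrite in_itv/= mul0r expr0 subrr mul0r => /andP[t0 _] t0'.
    by rewrite (le_anti (introT andP (conj t0' t0))) drift0 normr0.
  pose S := [set `|drift v U r| | r in [set r | r \in `[0, 1] /\ r <= j.+1%:R * h]].
  have [B ZB] := proj2 ZA; have [B' ZB'] := proj2 ZA'.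
  have Sub : has_ubound S.
    exists (Delta + (B + B')) => _ [r [r01 _] <-].
    have -> : drift v U r = (Z r - Z' r) - ((Z r - Z' r) - drift v U r) by rewrite subKr.
    rewrite (le_trans (ler_normB _ _))// addrC lerD ?dist_le//.
    by rewrite (le_trans (ler_normB _ _))// lerD ?ZB ?ZB'.
  pose m := sup S.
  have Sm r : r \in `[0, 1] -> r <= j.+1%:R * h -> `|drift v U r| <= m.
    by move=> r01 rj; apply: ub_le_sup => //; exists r.
  have m0 : 0 <= m by apply: le_trans (Sm t t01 tj).
  have c0 : 0 <= 2 ^+ j - 1 :> R by rewrite subr_ge0 exprn_ege1// ler1n.
  (* Self-improving bound: [m] occurs on the right, but only with weight 1/2. *)
  have m_le : m <= (2 ^+ j - 1) * Delta + (m + Delta) / 2.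
    apply: ge_sup; first by exists `|drift v U t|, t.
    move=> _ [r [r01 rj] <-].
    have [rtau|taur] := leP r (j%:R * h).
      rewrite (le_trans (IH r r01 rtau))// lerDl; lra.
    have tau01 : j%:R * h \in `[0, 1].
      rewrite in_itv/= mulr_ge0// ?ltW//=.
      by move: r01; rewrite in_itv/= => /andP[_]; exact: lt_le_trans.
    rewrite -[X in `|X|](subrK (drift v U (j%:R * h))) (le_trans (ler_normD _ _))// addrC.
    apply: lerD; first exact: IH.
    move: (r01) (tau01); rewrite !in_itv/= => /andP[r0 r1] /andP[tau0 tau1].
    have rtau : r - j%:R * h < eta.
      rewrite ltrBlDr (le_lt_trans rj)// -natr1 mulrDl mul1r addrC ltrD2r.
      by rewrite /h; lra.
    have Vle := etaP _ _ tau0 (ltW taur) r1 rtau.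
    have LmD : 0 <= L * (m + Delta) by rewrite mulr_ge0// addr_ge0.
    rewrite (le_trans (drift_increment vI UA tau0 (ltW taur) r1 LmD _))//.
      move=> k q; rewrite in_itv/= => /andP[tauq qr].
      have q01 : q \in `[0, 1].
        by rewrite in_itv/= (le_trans tau0 (ltW tauq)) (le_trans (ltW qr) r1).
      rewrite (le_trans (WL _ _ _))// ler_wpM2l// [m + _]addrC (le_trans (ZZ' q q01))// lerD2l.
      by rewrite Sm// (le_trans (ltW qr) rj).
    rewrite (le_trans (ler_wpM2l LmD Vle))// mulrAC mulrC ler_wpM2l// ?(addr_ge0 m0 Delta0)//.
    have L1 : 0 < 2 * (L + 1) by lra.
    by rewrite ler_pdivrMr// mulrA mulVf// mul1r lerDl.
  rewrite (le_trans (Sm t t01 tj))// exprS; move: m_le; set p := 2 ^+ j; lra.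
move=> t t01; rewrite (le_trans (ZZ' t t01))//.
have tn : t <= n%:R * h.
  by move: t01; rewrite in_itv/= => /andP[_ t1]; exact: le_trans nh.
by have := main n t t01 tn; set p := 2 ^+ n; lra.
Qed.

End Stability.

Section Limit.
Context {R : realType} {N d : nat}.
Variables (v : R -> 'cV[R]_d) (W : 'I_d -> 'cV[R]_N -> 'cV[R]_N) (a : 'cV[R]_N).

(** By stability the [Z_ n] are uniformly Cauchy, hence converge uniformly to some
    [S]. The defect of [S] differs from that of [Z_ n] by at most
    [(K + L K V) delta_n], where [V] is the variation of the control on [[0, 1]],
    so it vanishes. *)
Lemma approximate_solution_limit L (delta_ : nat -> R) (Z_ : nat -> R -> 'cV[R]_N) :
  integrable_control v -> lipschitz_field W L -> delta_ n @[n --> \oo] --> (0 : R) ->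
  (forall n, approximate_solution v W a (delta_ n) (Z_ n)) ->
  exists S, approximate_solution v W a 0 S.
Proof.
move=> vI WL delta0 ZP.
have [K K0 KP] := approximate_solution_stable a vI WL.
have deltaK c : c * delta_ n @[n --> \oo] --> (0 : R).
  by rewrite -(mulr0 c); apply: cvgM => //; exact: cvg_cst.
pose S t := lim (Z_ n t @[n --> \oo]).
have ZS t : t \in `[0, 1] -> Z_ n t @[n --> \oo] --> S t.
  move=> t01; apply: cauchy_cvg; apply: cauchy_exP => e e0.
  have e20 : 0 < e / 2 by rewrite divr_gt0.
  have [n _ nP] := cvgr_lt _ (deltaK K) _ e20.
  exists (Z_ n t); exists n => // m /= nm.
  rewrite -ball_normE /ball_/=.
  rewrite (le_lt_trans (KP _ _ _ _ (ZP n) (ZP m) t t01))// mulrDr [ltRHS](splitr e).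
  by rewrite ltrD ?nP//=.
have dist_le n t : t \in `[0, 1] -> `|Z_ n t - S t| <= K * delta_ n.
  move=> t01.
  have lhs : `|Z_ n t - Z_ m t| @[m --> \oo] --> `|Z_ n t - S t|.
    by apply: cvg_norm; apply: cvgB; [exact: cvg_cst | exact: ZS].
  have rhs : K * delta_ n + K * delta_ m @[m --> \oo] --> K * delta_ n + 0.
    by apply: cvgD; [exact: cvg_cst | exact: deltaK].
  rewrite -[leRHS]addr0; apply: (ler_cvg_to lhs rhs).
  by apply: nearW => m; rewrite -mulrDr; exact: KP.
have SA : admissible S.
  split=> [i|].
    apply: (measurable_fun_cvg (h := fun n t => Z_ n t i ord0)).
      by move=> n; apply: (ZP n).1.1.
    move=> t /= t01; apply/cvgrPdist_le => e e0.
    have /cvgrPdist_le/(_ _ e0) := ZS t t01; apply: filterS => n.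
    by apply: le_trans; have := mx_entry_le (S t - Z_ n t) i ord0; rewrite !mxE.
  have [B ZB] := (ZP 0%N).1.2.
  exists (B + K * delta_ 0%N) => t t01.
  have -> : S t = Z_ 0%N t - (Z_ 0%N t - S t) by rewrite subKr.
  by rewrite (le_trans (ler_normB _ _))// lerD ?ZB ?dist_le.
exists S; split => // t t01.
have [L0 Wl WA] := WL.
pose c := 1 + K + L * K * control_variation v 1.
have := deltaK c; move/cvgr_to_ge; apply; apply: nearW => n.
set D := drift _ _ _.
pose Dn := drift v (fun k s => W k (Z_ n s)) t.
have DnD : `|Dn - D| <= L * K * control_variation v 1 * delta_ n.
  rewrite /Dn /D driftB//; last 2 first.
  - by move=> k; apply: WA; exact: (ZP n).1.
  - by move=> k; apply: WA.
  set U := fun _ _ => _; rewrite -[X in `|X|]subr0 -(drift0 v U).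
  move: (t01); rewrite in_itv/= => /andP[t0 t1].
  have dn0 := approximate_solution_ge0 (ZP n).
  have Ldn : 0 <= L * (K * delta_ n) by rewrite !mulr_ge0.
  rewrite (le_trans (drift_increment vI _ (lexx 0) t0 t1 Ldn _))//.
  - by move=> k; apply: admissibleB; apply: WA => //; exact: (ZP n).1.
  - move=> k r; rewrite in_itv/= => /andP[r0 rt].
    rewrite (le_trans (Wl _ _ _))// ler_wpM2l// dist_le// in_itv/= (ltW r0).
    by rewrite (le_trans (ltW rt)).
  rewrite mulrA mulrAC ler_wpM2r// ler_wpM2l ?mulr_ge0//.
  rewrite lerBlDr (le_trans (control_variation_homo vI t0 t1 (lexx 1)))//.
  by rewrite lerDl control_variation_ge0.
have -> : S t - (a + D) = (Z_ n t - (a + Dn)) - (Z_ n t - S t) + (Dn - D).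
  rewrite !opprD !opprK !addrA.
  by rewrite [RHS](ACl (5*2*7*1*4*3*6))/= addrK addrNK.
rewrite (le_trans (ler_normD _ _))// (le_trans (lerD (ler_normB _ _) (lexx _)))//.
have := (ZP n).2 t t01; rewrite -/Dn => Zn.
by rewrite /c !mulrDl mul1r !lerD// ?dist_le.
Qed.

End Limit.

(** * Step functions on a partition *)

Lemma mesh_ge0 (R : realType) (s : seq R) : 0 <= mesh s.
Proof. by rewrite /mesh; elim/big_ind: _ => // u w u0 w0; rewrite le_max u0. Qed.

Section Steps.
Context {R : realType}.
Variables (s : seq R) (s_part : itv_partition 0 1 s).
Local Notation knot := (nth 0 (knots s)).

Definition step n (y : nat -> 'cV[R]_n) (t : R) : 'cV[R]_n :=
  y (index (rho s t) (knots s)).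

Lemma knot_lt i j : (i < j <= size s)%N -> knot i < knot j.
Proof.
move=> /andP[ij js]; have [p _] := s_part.
have := sorted_ltn_nth lt_trans 0 (p : sorted <%R (knots s)).
by apply => //=; rewrite inE ltnS//= (leq_trans (ltnW ij)).
Qed.

Lemma knot_le i j : (i <= j <= size s)%N -> knot i <= knot j.
Proof.
move=> /andP[]; rewrite leq_eqVlt => /predU1P[->//|ij] js.
by rewrite ltW// knot_lt// ij.
Qed.

Lemma knot_last : knot (size s) = 1.
Proof. exact: itv_partition_nth_size s_part. Qed.

Lemma knot01 i : (i <= size s)%N -> knot i \in `[0, 1].
Proof.
move=> iS; rewrite in_itv/=; apply/andP; split.
  by apply: (@knot_le 0%N).
by rewrite -knot_last knot_le// iS leqnn.
Qed.

Lemma knot_mesh i : (i < size s)%N -> knot i.+1 - knot i <= mesh s.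
Proof.
move=> iS; rewrite (le_trans (ler_norm _))//.
exact: (le_bigmax _ (fun i : 'I_(size s) => `|knot i.+1 - knot i|) (Ordinal iS)).
Qed.

Variant index_rho_spec (t : R) : nat -> Prop :=
  | IndexRhoInner i of (i < size s)%N & knot i <= t < knot i.+1 : index_rho_spec t i
  | IndexRhoLast of t = 1 : index_rho_spec t (size s).

Lemma index_rhoP t : t \in `[0, 1] -> index_rho_spec t (index (rho s t) (knots s)).
Proof.
move=> t01; have /andP[t0 t1] : 0 <= t <= 1 by rewrite in_itv in t01.
have ex : exists i, (i <= size s)%N && (knot i <= t) by exists 0%N; rewrite leq0n t0.
have bd i : (i <= size s)%N && (knot i <= t) -> (i <= size s)%N by case/andP.
set i' := index _ _; case: (ex_maxnP ex bd) => i /andP[iS it] imax.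
have rhoE : rho s t = knot i.
  apply/le_anti/andP; split.
    apply: ge_sup; first by exists (knot i); split => //; apply: mem_nth; rewrite ltnS.
    move=> r [/(nthP 0)[j]]; rewrite ltnS => jS <- jt.
    by rewrite knot_le// iS andbT imax// jS.
  apply: ub_le_sup; first by exists t => r [].
  by split => //; apply: mem_nth; rewrite ltnS.
have u : uniq (knots s) by apply: lt_sorted_uniq; have [] := s_part.
have -> : i' = i by rewrite /i' rhoE index_uniq// ltnS.
move: iS; rewrite leq_eqVlt => /predU1P[iS|iS].
  rewrite iS; apply: IndexRhoLast; apply/le_anti; rewrite t1/=.
  by rewrite -knot_last -iS.
apply: IndexRhoInner => //; rewrite it/= ltNge; apply/negP => it'.
by have := imax i.+1; rewrite iS it' => /(_ isT); rewrite ltnn.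
Qed.

Lemma index_rho_le t : t \in `[0, 1] -> (index (rho s t) (knots s) <= size s)%N.
Proof. by case/index_rhoP => // i /ltnW. Qed.

(** A step function as a telescoping sum of jumps, in which its measurability can be
    read off. *)
Lemma stepE n (y : nat -> 'cV[R]_n) t : t \in `[0, 1] ->
  step y t = y 0%N + \sum_(j < size s) \1_`[knot j.+1, +oo[ t *: (y j.+1 - y j).
Proof.
move=> t01; rewrite /step; set i := index _ _.
have iS : (i <= size s)%N by exact: index_rho_le.
rewrite (eq_bigr (fun j : 'I_(size s) => if (j < i)%N then y j.+1 - y j else 0)); last first.
  move=> j _; rewrite indicE.
  have -> : (t \in [set` `[knot j.+1, +oo[]) = (j < i)%N.
    rewrite mem_setE (_ : (t \in _) = (knot j.+1 <= t)); last by rewrite in_itv/= andbT.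
    rewrite /i.
    have [k kS /andP[kt tk]|->] := index_rhoP t01.
      have [jk|kj] := ltnP j k.
        by rewrite (le_trans _ kt)// knot_le// jk ltnW.
      by apply/negbTE; rewrite -ltNge (lt_le_trans tk)// knot_le// ltnS kj ltn_ord.
    by rewrite ltn_ord -knot_last knot_le// ltn_ord leqnn.
  by case: ifPn; rewrite ?scale1r ?scale0r.
rewrite -big_mkcond/= -(big_ord_widen _ (fun j => y j.+1 - y j) iS).
by rewrite -(big_mkord xpredT (fun j => y j.+1 - y j)) telescope_sumr// subrKC.
Qed.

Lemma admissible_step n (y : nat -> 'cV[R]_n) : admissible (step y).
Proof.
split=> [i|].
  apply: (eq_measurable_fun (fun t => y 0%N i ord0 + \sum_(j < size s)
     (y j.+1 - y j) i ord0 * \1_`[knot j.+1, +oo[ t)).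
    move=> t; rewrite inE => t01; rewrite stepE// mxE summxE; congr (_ + _).
    by apply: eq_bigr => j _; rewrite [in RHS]mxE mulrC.
  apply: measurable_funD; first exact: measurable_cst.
  apply: measurable_sum => j; apply: measurable_funM; first exact: measurable_cst.
  exact: measurable_indic.
exists (\sum_(j < (size s).+1) `|y j|) => t /index_rho_le tS.
rewrite /step (bigD1 (inord (index (rho s t) (knots s))))//= inordK//.
by rewrite lerDl sumr_ge0.
Qed.

End Steps.

(** * The network as an Euler scheme *)

Section Euler.
Context {R : realType} {N d : nat}.
Variables (phi : R -> R) (a : 'cV[R]_N) (A : 'I_d -> 'M[R]_N) (b : 'I_d -> 'cV[R]_N).
Variables (x v : R -> 'cV[R]_d).
Hypotheses (vI : integrable_control v) (xv : L2_derivative x v).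
Local Notation W := (vector_field phi A b).
Local Notation V := (control_variation v).

Lemma drift_cst (c : 'I_d -> 'cV[R]_N) t : t \in `[0, 1] ->
  drift v (fun k _ => c k) t = \sum_(k < d) (x t k ord0 - x 0 k ord0) *: c k.
Proof.
move=> t01; apply/colP => i; rewrite !mxE summxE; apply: eq_bigr => k _.
rewrite mxE xv.2// mulrC RintegralZl//.
move: t01; rewrite in_itv/= => /andP[_ t1].
by apply: integrableS (vI k) => //; exact: itv0S.
Qed.

(** The control increments multiply a field that is frozen at the current state,
    so that one layer of the network is an integral of a constant. *)
Lemma resnet_increment (t : nat -> R) j : t j \in `[0, 1] -> t j.+1 \in `[0, 1] ->
  let c := fun k (_ : R) => W k (resnet phi a A b x t j) in
  resnet phi a A b x t j.+1 - resnet phi a A b x t j = drift v c (t j.+1) - drift v c (t j).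
Proof.
move=> tj tj1 c; rewrite !drift_cst// -sumrB /= addrAC subrr add0r.
by apply: eq_bigr => k _; rewrite -scalerBl opprB addrA subrK.
Qed.

Lemma lipschitz_field_growth L : lipschitz_field W L ->
  exists2 C, 0 <= C & forall k y, `|W k y| <= C * (1 + `|y|).
Proof.
move=> [L0 WL _]; have S0 : 0 <= \sum_(k < d) `|W k 0| by exact: sumr_ge0.
exists (L + \sum_(k < d) `|W k 0|) => [|k y]; first exact: addr_ge0.
have Wk : `|W k 0| <= \sum_(k < d) `|W k 0| by rewrite (bigD1 k)//= lerDl sumr_ge0.
have := WL k y 0; rewrite subr0 => Wy.
rewrite -[X in `|X|](subrK (W k 0)) (le_trans (ler_normD _ _))//.
by have := normr_ge0 y; nra.
Qed.

(** Discrete Gronwall: each layer multiplies [1 + |state|] by at most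
    [1 + C dV <= exp (C dV)], and the increments [dV] of the variation add up.
    The resulting bound does not depend on the partition. *)
Lemma resnet_bound C (t : nat -> R) n : 0 <= C ->
  (forall k y, `|W k y| <= C * (1 + `|y|)) ->
  (forall j, (j <= n)%N -> t j \in `[0, 1]) ->
  (forall j, (j < n)%N -> t j <= t j.+1) ->
  forall j, (j <= n)%N ->
    1 + `|resnet phi a A b x t j| <= (1 + `|a|) * expR (C * V (t j)).
Proof.
move=> C0 WC t01 tle; elim=> [_|j IH jn].
  rewrite ler_peMr ?addr_ge0// (le_trans _ (expR_ge1Dx _))// lerDl.
  by rewrite mulr_ge0// control_variation_ge0.
have tj := t01 _ (ltnW jn); have tj1 := t01 _ jn; have tt := tle _ jn.
have := resnet_increment tj tj1; set S := resnet _ _ _ _ _ _ j; move=> /= SE.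
rewrite -(subrK S (_ + _)) SE.
have CS : 0 <= C * (1 + `|S|) by rewrite mulr_ge0// addr_ge0.
move: (tj) (tj1); rewrite !in_itv/= => /andP[tj0 _] /andP[_ tj11].
have := drift_increment (U := fun k _ => W k S) vI (fun k => admissible_cst _) tj0 tt tj11 CS
  (fun k _ _ => WC k S).
set D := drift _ _ _ - _; set dV := _ - _ => Dle.
rewrite (@le_trans _ _ ((1 + `|S|) * expR (C * dV)))//.
  rewrite (@le_trans _ _ ((1 + `|S|) * (1 + C * dV)))//.
    by have := ler_normD D S; lra.
  by rewrite ler_wpM2l ?addr_ge0// expR_ge1Dx.
have -> : C * V (t j.+1) = C * V (t j) + C * dV by rewrite -mulrDr addrC subrK.
by rewrite expRD mulrA ler_wpM2r ?expR_ge0// IH// ltnW.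
Qed.

(** Let [Y] be the drift of the piecewise constant path [Z] started at [a]. At
    each knot [Y = Z], because on the interval before it the integrand is frozen.
    Between knots [Z] stays put while [Y] moves by at most the sup of the field
    times the variation of the control since the last knot. *)
Lemma resnet_approximate L : lipschitz_field W L ->
  exists2 B, 0 <= B & forall s, itv_partition 0 1 s -> forall e,
    (forall r t, 0 <= r -> r <= t -> t <= 1 -> t - r <= mesh s -> V t - V r <= e) ->
    approximate_solution v W a (B * e) (resnet_path phi a A b x s).
Proof.
move=> WLip; have [L0 WL WA] := WLip.
have [C C0 WC] := lipschitz_field_growth WLip.
pose B := C * ((1 + `|a|) * expR (C * V 1)).
have B0 : 0 <= B by rewrite !mulr_ge0 ?addr_ge0 ?expR_ge0.
exists B => // s s_part e Ve.
pose knot := nth 0 (knots s).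
pose S := resnet phi a A b x knot.
have k01 j : (j <= size s)%N -> knot j \in `[0, 1] by exact: knot01.
have kle j : (j < size s)%N -> knot j <= knot j.+1.
  by move=> js; apply: knot_le => //; rewrite leqnSn.
have WS k j : (j <= size s)%N -> `|W k (S j)| <= B.
  move=> js; rewrite (le_trans (WC _ _))// ler_wpM2l//.
  have Sj : 1 + `|S j| <= (1 + `|a|) * expR (C * V (knot j)).
    exact: (@resnet_bound C knot (size s)).
  apply: (le_trans Sj); apply: ler_wpM2l; first exact: addr_ge0.
  rewrite ler_expR ler_wpM2l//.
  by have := k01 j js; rewrite in_itv/= => /andP[? ?]; exact: control_variation_homo.
have ZA : admissible (resnet_path phi a A b x s) by exact: (admissible_step s_part S).
set Z := resnet_path _ _ _ _ _ _ in ZA *.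
split => // t t01.
pose Y t := a + drift v (fun k r => W k (Z r)) t.
(* The path [Y] passes through the network states at the knots. *)
have Yknot j : (j <= size s)%N -> Y (knot j) = S j.
  elim: j => [_|j IH js]; first by rewrite /Y drift0 addr0.
  have kj := k01 _ (ltnW js); have kj1 := k01 _ js.
  have WZA k : admissible (fun r => W k (Z r)) by exact: WA.
  apply/eqP; rewrite -(subr_eq0 (Y _)) -normr_le0.
  rewrite -[S j.+1](subrK (S j)) (resnet_increment kj kj1) -/(S j) -(IH (ltnW js)).
  have regroup (D1 D0 E1 E0 : 'cV[R]_N) :
      a + D1 - (E1 - E0 + (a + D0)) = (D1 - E1) - (D0 - E0).
    by rewrite !opprD !opprK !addrA [LHS](ACl (2*3*6*4*1*5))/= addrK.
  rewrite {1 2}/Y regroup.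
  have cstA k : admissible (fun _ : R => W k (Y (knot j))) by exact: admissible_cst.
  rewrite (driftB vI WZA cstA kj1) (driftB vI WZA cstA kj).
  have cA k : admissible (fun r => W k (Z r) - W k (Y (knot j))).
    by exact: admissibleB.
  move: (kj) (kj1); rewrite !in_itv/= => /andP[kj0 _] /andP[_ kj11].
  have := drift_increment (B := 0) vI cA kj0 (kle _ js) kj11 (lexx _).
  (* The two integrands agree between the knots [j] and [j + 1]. *)
  rewrite mul0r; apply => k r; rewrite in_itv/= => /andP[jr rj].
  have r01 : r \in `[0, 1] by rewrite in_itv/= (le_trans kj0 (ltW jr)) (le_trans (ltW rj) kj11).
  rewrite (IH (ltnW js)) /Z /resnet_path.
  case: (index_rhoP s_part r01) => [i iS /andP[ir ri]|r1]; last first.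
    by move: rj; rewrite r1 ltNge kj11.
  have -> : i = j.
    apply/eqP; rewrite eqn_leq; apply/andP; split; rewrite leqNgt; apply/negP => ij.
      have := knot_le s_part (i := j.+1) (j := i); rewrite ij (ltnW iS) => /(_ isT) le1.
      by have := lt_le_trans rj le1; rewrite ltNge ir.
    have := knot_le s_part (i := i.+1) (j := j); rewrite ij (ltnW js) => /(_ isT) le1.
    by have := lt_trans (lt_le_trans ri le1) jr; rewrite ltxx.
  by rewrite subrr normr0.
have [i iS [ZtE it ti]] : exists2 i, (i <= size s)%N &
    [/\ Z t = S i, knot i <= t & t - knot i <= mesh s].
  rewrite /Z /resnet_path; case: (index_rhoP s_part t01) => [i iS /andP[it ti]|->].
    exists i; first exact: ltnW.
    split => //; rewrite (le_trans _ (knot_mesh iS))//.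
    by rewrite lerD2r ltW.
  exists (size s) => //; rewrite /knot knot_last//; split => //.
  by rewrite subrr mesh_ge0.
rewrite ZtE -(Yknot i iS) -/(Y t) /Y opprD addrACA subrr add0r distrC.
have := k01 i iS; move: (t01); rewrite !in_itv/= => /andP[t0 t1] /andP[ki0 _].
rewrite (le_trans (drift_increment vI _ ki0 it t1 B0 _))//; last by rewrite ler_wpM2l// Ve.
  by move=> k; exact: WA.
move=> k r; rewrite in_itv/= => /andP[jr rj]; apply: WS.
apply: index_rho_le => //.
by rewrite in_itv/= (le_trans ki0 (ltW jr)) (le_trans (ltW rj) t1).
Qed.

End Euler.

Section Oscillation.
Context {R : realType} {d : nat}.
Variables (v : R -> 'cV[R]_d) (vI : integrable_control v).
Local Notation V := (control_variation v).

(** The modulus of continuity of the variation of the control; it turns the mesh of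
    a partition into the defect of the Euler scheme. *)
Definition control_oscillation (h : R) : R :=
  sup [set V p.2 - V p.1 | p in [set p : R * R |
    [/\ 0 <= p.1, p.1 <= p.2, p.2 <= 1 & p.2 - p.1 <= h]]].

Lemma control_oscillation_ge h r t : 0 <= r -> r <= t -> t <= 1 -> t - r <= h ->
  V t - V r <= control_oscillation h.
Proof.
move=> r0 rt t1 trh; apply: ub_le_sup; last by exists (r, t).
exists (V 1) => _ [p [p0 p12 p1 _] <-].
rewrite lerBlDr (le_trans (control_variation_homo vI (le_trans p0 p12) p1 (lexx 1)))//.
by rewrite lerDl control_variation_ge0.
Qed.

Lemma control_oscillation_cvg0 (h_ : nat -> R) : (forall n, 0 <= h_ n) ->
  h_ n @[n --> \oo] --> (0 : R) ->
  control_oscillation (h_ n) @[n --> \oo] --> (0 : R).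
Proof.
move=> h0 hcvg; apply/cvgrPdist_le => e e0.
have [eta eta0 etaP] := control_variation_modulus vI e0.
have [m _ hm] := cvgr_lt _ hcvg _ eta0; exists m => // n /= /hm/= hn.
rewrite sub0r normrN ger0_norm.
  apply: ge_sup; first by exists 0, (0, 0); rewrite /= ?subrr.
  by move=> _ [p [p0 p12 p1 ph] <-]; apply: etaP => //; exact: le_lt_trans hn.
have := @control_oscillation_ge (h_ n) 0 0 (lexx 0) (lexx 0) ler01.
by rewrite !subrr; exact.
Qed.

End Oscillation.

(** * Vector fields and derivatives of paths *)

Section VectorField.
Context {R : realType} {N d : nat}.

Lemma lipschitz_bound (phi : R -> R) : lipschitz (phi : R^o -> R^o) ->
  exists2 l, 0 <= l & forall u w, `|phi u - phi w| <= l * `|u - w|.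
Proof.
move=> lip; near (pinfty_nbhs R) => l.
exists l; first by near: l; exact: nbhs_pinfty_ge.
move=> u w; have : l.-lipschitz (phi : R^o -> R^o) by near: l.
by move=> /(_ (u, w)) /=; apply.
Unshelve. all: by end_near. Qed.

Lemma lipschitz_measurable (phi : R -> R) : lipschitz (phi : R^o -> R^o) ->
  measurable_fun setT phi.
Proof.
move=> /lipschitz_bound[l l0 lip].
apply: continuous_measurable_fun => u; apply/cvgrPdist_le => e e0.
have l1 : 0 < l + 1 by rewrite ltr_wpDl.
near=> w; rewrite (le_trans (lip _ _))//.
rewrite (@le_trans _ _ ((l + 1) * `|u - w|))//.
  by rewrite ler_wpM2r// lerDl.
rewrite mulrC -ler_pdivlMr//; near: w.
by apply: cvgr_dist_le; [exact: cvg_id | rewrite divr_gt0].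
Unshelve. all: by end_near. Qed.

(** The sum of all the entries of all the [A k] is a crude but uniform bound for
    their operator norms for the maximum norm. *)
Lemma vector_field_lipschitz (phi : R -> R) (A : 'I_d -> 'M[R]_N)
    (b : 'I_d -> 'cV[R]_N) : lipschitz (phi : R^o -> R^o) ->
  exists L, lipschitz_field (vector_field phi A b) L.
Proof.
move=> Lphi; have [l l0 lip] := lipschitz_bound Lphi.
have S0 k i : 0 <= \sum_j `|A k i j| by exact: sumr_ge0.
have phim := lipschitz_measurable Lphi.
exists (l * \sum_k \sum_i \sum_j `|A k i j|); split.
- by rewrite mulr_ge0// !sumr_ge0// => k _; exact: sumr_ge0.
- move=> k y z; rewrite /vector_field opprD addrACA subrr addr0 -mulmxBr.
  have c0 : 0 <= l * (\sum_k \sum_i \sum_j `|A k i j|) * `|y - z|.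
    by rewrite !mulr_ge0// !sumr_ge0// => ? _; exact: sumr_ge0.
  apply: cV_norm_le => // i; rewrite mxE (le_trans (ler_norm_sum _ _ _))//.
  rewrite (@le_trans _ _ (\sum_j `|A k i j| * (l * `|y - z|)))//.
    apply: ler_sum => j _; rewrite normrM ler_wpM2l// !mxE (le_trans (lip _ _))//.
    by rewrite ler_wpM2l//; have := mx_entry_le (y - z) j ord0; rewrite !mxE.
  rewrite -mulr_suml mulrCA mulrA ler_wpM2r// ler_wpM2l//.
  rewrite (@le_trans _ _ (\sum_i \sum_j `|A k i j|))//.
    by rewrite [leRHS](bigD1 i)//= lerDl sumr_ge0.
  rewrite [leRHS](bigD1 k)//= lerDl sumr_ge0// => k' _; exact: sumr_ge0.
- move=> k Z [Zm [B ZB]]; split=> [i|].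
    have -> : (fun t => vector_field phi A b k (Z t) i ord0) =
              (fun t => (\sum_j A k i j * phi (Z t j ord0)) + b k i ord0).
      by apply/funext => t; rewrite !mxE; congr (_ + _); apply: eq_bigr => j _; rewrite mxE.
    apply: measurable_funD; last exact: measurable_cst.
    apply: measurable_sum => j; apply: measurable_funM; first exact: measurable_cst.
    exact: measurableT_comp (Zm j).
  exists ((\sum_i \sum_j `|A k i j|) * (l * B + `|phi 0|) + `|b k|) => t t01.
  rewrite (le_trans (ler_normD _ _))// lerD2r.
  have B0 : 0 <= B by exact: le_trans (ZB t t01).
  apply: cV_norm_le => [|i].
    by rewrite !mulr_ge0// ?addr_ge0 ?mulr_ge0// sumr_ge0.
  rewrite mxE (le_trans (ler_norm_sum _ _ _))//.
  rewrite (@le_trans _ _ (\sum_j `|A k i j| * (l * B + `|phi 0|)))//; last first.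
    rewrite -mulr_suml ler_wpM2r// ?addr_ge0 ?mulr_ge0//.
    by rewrite [leRHS](bigD1 i)//= lerDl sumr_ge0.
  apply: ler_sum => j _; rewrite normrM ler_wpM2l// mxE.
  rewrite -[X in `|X|](subrK (phi 0)) (le_trans (ler_normD _ _))// lerD2r.
  rewrite (le_trans (lip _ _))// ler_wpM2l// subr0 (le_trans (mx_entry_le _ _ _))//.
  exact: ZB.
Qed.

End VectorField.

Section PathDerivative.
Context {R : realType} {d : nat}.

Lemma dot_derivative (x : R -> 'cV[R]_d) : path_space x -> L2_derivative x (dot x).
Proof. by move=> [_ _ [v xv]]; apply: (@xgetPex _ _ [set v | L2_derivative x v]); exists v. Qed.

Lemma leb01_ae (Q : R -> Prop) : (forall t, t \in `[0, 1] -> Q t) ->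
  \forall t \ae (leb01 R), Q t.
Proof.
move=> HQ; exists (~` [set` `[0, 1]]); split.
- by apply: measurableC; exact: measurable_itv.
- by rewrite /leb01/= /mrestr setICl measure0.
- by move=> t /= nQ t01; apply: nQ; exact: HQ.
Qed.

(** On the finite measure space [[0, 1]] one has L^2 in L^1; the restricted measure
    and Lebesgue measure have the same integrals over [[0, 1]]. *)
Lemma L2_derivative_integrable (x v : R -> 'cV[R]_d) : L2_derivative x v ->
  integrable_control v.
Proof.
move=> [v2 _] k.
have fin : leb01 R setT \is a fin_num.
  by rewrite /leb01/= /mrestr setTI lebesgue_measure_itv/= lte01.
have /Lfun1_integrable vI := Lfun_subset12 fin (v2 k).
have vI' : (leb01 R).-integrable `[0, 1] (EFin \o (fun s => v s k ord0)).
  by apply: integrableS vI => //; exact: measurable_itv.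
move/integrableP : vI' => [vm vfin]; apply/integrableP; split => //.
rewrite (eq_measure_integral (leb01 R))// => B mB B01.
by rewrite /leb01/= /mrestr setIidl.
Qed.

End PathDerivative.

Section Solutions.
Context {R : realType} {N d : nat}.
Variables (phi : R -> R) (a : 'cV[R]_N) (A : 'I_d -> 'M[R]_N) (b : 'I_d -> 'cV[R]_N).
Variable x : R -> 'cV[R]_d.
Hypothesis vI : integrable_control (dot x).
Local Notation W := (vector_field phi A b).

Lemma admissible_continuous n (y : R -> 'cV[R]_n) :
  {within `[0 : R, 1 : R], continuous y} -> admissible y.
Proof.
move=> cy; split=> [i|].
  apply: subspace_continuous_measurable_fun => //.
  apply/subspace_continuousP => t t01; apply/cvgrPdist_le => e e0.
  have /subspace_continuousP/(_ t t01)/cvgrPdist_le/(_ e e0) := cy.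
  apply: filterS => r; apply: le_trans.
  by have := mx_entry_le (y t - y r) i ord0; rewrite !mxE.
have /compact_bounded[B [_ yB]] := continuous_compact cy (segment_compact (a := 0) (b := 1)).
exists (`|B| + 1) => t t01; apply: yB; last by exists t.
by rewrite (le_lt_trans (ler_norm _))// ltrDl.
Qed.

(** From right to left the continuity of [y] comes for free: [y] is [a] plus a drift
    with a bounded integrand, so its increments are controlled by those of the
    variation. *)
Lemma ncde_solutionP L y : lipschitz_field W L ->
  ncde_solution phi a A b x y <-> approximate_solution (dot x) W a 0 y.
Proof.
move=> [L0 WL WA]; split=> [[cy yE]|[yA yE]].
  split=> [|t t01]; first exact: admissible_continuous.
  rewrite normr_le0 subr_eq0; apply/eqP/colP => i; rewrite !mxE.
  exact: yE.
have {}yE t : t \in `[0, 1] -> y t = a + drift (dot x) (fun k s => W k (y s)) t.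
  by move=> /yE; rewrite normr_le0 subr_eq0 => /eqP.
split=> [|t t01 i]; last by rewrite yE// !mxE.
have WyA k : admissible (fun s => W k (y s)) by exact: WA.
have /choice[B_ BP] : forall k, exists B, forall t, t \in `[0, 1] -> `|W k (y t)| <= B.
  by move=> k; exact: (WyA k).2.
pose B := \sum_k `|B_ k|.
have B0 : 0 <= B by exact: sumr_ge0.
have WB k t : t \in `[0, 1] -> `|W k (y t)| <= B.
  move=> t01; rewrite (le_trans (BP k t t01))// (le_trans (ler_norm _))//.
  by rewrite /B (bigD1 k)//= lerDl sumr_ge0.
have incr e : 0 < e -> exists2 eta, 0 < eta & forall r t, r \in `[0, 1] -> t \in `[0, 1] ->
    r <= t -> t - r < eta -> `|y t - y r| <= e.
  move=> e0; have Be : 0 < e / (B + 1) by rewrite divr_gt0// ltr_wpDl.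
  have [eta eta0 etaP] := control_variation_modulus vI Be; exists eta => // r t r01 t01 rt tr.
  rewrite !yE// opprD addrACA subrr add0r.
  move: r01 t01; rewrite !in_itv/= => /andP[r0 r1] /andP[t0 t1].
  rewrite (le_trans (drift_increment vI WyA r0 rt t1 B0 _))//.
    move=> k q; rewrite in_itv/= => /andP[rq qt]; apply: WB.
    by rewrite in_itv/= (le_trans r0 (ltW rq)) (le_trans (ltW qt) t1).
  rewrite (le_trans (ler_wpM2l B0 (etaP _ _ r0 rt t1 tr)))//.
  by rewrite mulrCA ler_piMr ?ltW// ltr_pdivrMr ?ltr_wpDl// mul1r ltrDl.
apply/subspace_continuousP => t /= t01; apply/cvgrPdist_le => e e0.
have [eta eta0 etaP] := incr e e0.
near=> r.
have r01 : r \in `[0, 1] by near: r; exact: withinT.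
have rt : `|t - r| < eta.
  by near: r; apply: cvg_within; exists eta.
have [rlet|tler] := leP r t.
  by apply: etaP => //; rewrite (le_lt_trans (ler_norm _)).
by rewrite distrC; apply: etaP => //; [exact: ltW | rewrite (le_lt_trans (ler_norm _))// distrC].
Unshelve. all: by end_near. Qed.

End Solutions.

(** * Borel measurability and convergence in distribution *)

Section BorelMeasurability.
Context {R : realType} {disp : measure_display} {T : measurableType disp}.

Lemma borel_measurableP (E : ptopologicalType) (X : T -> E) :
  borel_measurable X <-> forall U, open U -> measurable (X @^-1` U).
Proof.
split=> [Xm U oU|XU].
  have mU : (@measurable _ (g_sigma_algebraType (@open E))) U by exact: sub_sigma_algebra.
  by have := Xm measurableT U mU; rewrite setTI.
apply: (@measurability _ _ _ (g_sigma_algebraType (@open E)) setT X (@open E)) => //.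
by move=> _ [U oU <-]; rewrite setTI; exact: XU.
Qed.

(** [L^oo] is not second countable, so that the open set is not decomposed into
    balls; it is exhausted by smaller open sets instead. If [U_ k] is the interior of the set of
    points whose ball of radius [1 / (k + 1)] lies in [U], then the limit lies in
    [U] if and only if, for some [k], the sequence is eventually in [U_ k]. *)
Lemma borel_measurable_limit (E : pseudoPMetricType R) (X_ : nat -> T -> E) (X : T -> E) :
  (forall n, borel_measurable (X_ n)) ->
  (forall w, X_ n w @[n --> \oo] --> X w) -> borel_measurable X.
Proof.
move=> Xm Xcvg; apply/borel_measurableP => U oU.
pose r k : R := k.+1%:R^-1.
have r0 k : 0 < r k by rewrite invr_gt0.
pose U_ k := [set u | ball u (r k) `<=` U]^°.
have -> : X @^-1` U = \bigcup_k \bigcup_m \bigcap_(n in [set n | (m <= n)%N]) (X_ n @^-1` U_ k).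
  apply/seteqP; split => [w Uw|w [k _ [m _ mU]]].
    have /nbhs_ballP[e /= e0 eU] : nbhs (X w) U by exact: open_nbhs_nbhs.
    pose k := Num.trunc (2 / e).
    have rk : r k + r k <= e.
      rewrite /r -mulr2n -[leLHS]mulr_natl ler_pdivrMr// mulrC -ler_pdivrMr//.
      by rewrite ltW// truncnS_gt.
    have nb : nbhs (X w) (U_ k).
      apply: nbhs_interior; apply/nbhs_ballP; exists (r k) => //= u Xu y uy.
      by apply: eU; apply: le_ball rk _ _; exact: ball_triangle Xu uy.
    have [m _ mU] := Xcvg w _ nb.
    by exists k => //; exists m => // n /= /mU.
  have [n mn /= nX] : exists2 n, (m <= n)%N & ball (X w) (r k) (X_ n w).
    have [m' _ m'X] := Xcvg w _ (nbhsx_ballx (X w) _ (r0 k)).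
    by exists (maxn m m'); [exact: leq_maxl | apply: m'X; exact: leq_maxr].
  have /interior_subset/= := mU n mn; apply.
  exact: ball_sym.
apply: bigcupT_measurable => k; apply: bigcupT_measurable => m.
apply: bigcap_measurableType => n _.
by apply/(borel_measurableP (X_ n)).1 => //; exact: open_interior.
Qed.

Lemma borel_measurable_comp (E : ptopologicalType) (f : E -> R) (X : T -> E) :
  continuous f -> borel_measurable X -> measurable_fun setT (f \o X).
Proof.
move=> /continuousP cf /borel_measurableP Xm.
apply: (measurability _ (RGenOpens.measurableE R)) => _ [_ [a [b ->]] <-].
by rewrite setTI comp_preimage; apply: Xm; apply: cf; exact: interval_open.
Qed.

(** An open set of matrices is a countable union of boxes with rational centre, and
    belonging to a box is a condition on each entry. *)
Lemma measurable_mx_open m n (Y : T -> 'M[R]_(m, n)) :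
  (forall i j, measurable_fun setT (fun w => Y w i j)) ->
  forall U, open U -> measurable (Y @^-1` U).
Proof.
move=> Ym U oU.
pose F (q : 'M[rat]_(m, n) * nat) := [set w | ball (map_mx ratr q.1 : 'M[R]_(m, n))
   q.2.+1%:R^-1 `<=` U /\ forall i j, ball (ratr (q.1 i j) : R) q.2.+1%:R^-1 (Y w i j)].
have -> : Y @^-1` U = \bigcup_q F q.
  apply/seteqP; split => [w Uw|w [q _ [qU qw]]]; last first.
    by apply: qU; split => // i j; rewrite mxE.
  have /nbhs_ballP[e /= e0 eU] : nbhs (Y w) U by exact: open_nbhs_nbhs.
  (* A rational box of radius [r <= e / 2] around a point close to [Y w]. *)
  pose k := Num.trunc (2 / e); pose r : R := k.+1%:R^-1.
  have r0 : 0 < r by rewrite invr_gt0.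
  have rk : r + r <= e.
    rewrite /r -mulr2n -[leLHS]mulr_natl ler_pdivrMr// mulrC -ler_pdivrMr//.
    by rewrite ltW// truncnS_gt.
  have /choice[q qP] : forall ij, exists q : rat, ball (ratr q : R) r (Y w ij.1 ij.2).
    move=> [i j]; have [q qr] := @rat_in_itvoo R (Y w i j - r) (Y w i j + r) ltac:(lra).
    exists q; apply: ball_sym; rewrite -ball_normE/= ltr_distlC.
    by move: qr; rewrite in_itv.
  exists (\matrix_(i, j) q (i, j), k) => //; split => /= [y qy|i j]; last first.
    by rewrite mxE; exact: (qP (i, j)).
  apply: eU; apply: le_ball rk _ _; apply: ball_triangle qy.
  by split=> // i j; rewrite !mxE; apply: ball_sym; exact: (qP (i, j)).
apply: countable_bigcupT_measurable => // q.
have [qU|qU] := pselect (ball (map_mx ratr q.1 : 'M[R]_(m, n)) q.2.+1%:R^-1 `<=` U); last first.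
  rewrite (_ : F q = set0)//; apply/seteqP; split => // w []//.
rewrite (_ : F q = \bigcap_(i in [set: 'I_m]) \bigcap_(j in [set: 'I_n])
    ((fun w => Y w i j) @^-1` ball (ratr (q.1 i j) : R) q.2.+1%:R^-1)).
  apply: fin_bigcap_measurable => // i _; apply: fin_bigcap_measurable => // j _.
  rewrite -[X in measurable X]setTI; apply: Ym => //.
  by apply: open_measurable; exact: ball_open.
apply/seteqP; split => [w [_ qw] i _ j _|w qw]; first exact: qw.
by split => // i j; exact: qw.
Qed.

End BorelMeasurability.

Section Convergence.
Context {R : realType} {disp : measure_display} {T : measurableType disp}.
Variable P : probability T R.

(** Dominated convergence, with the bound of the test function as the dominating
    constant. *)
Lemma cvg_in_distribution_pointwise (E : pseudoPMetricType R)
    (X_ : nat -> T -> E) (X : T -> E) :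
  (forall n, borel_measurable (X_ n)) ->
  (forall w, X_ n w @[n --> \oo] --> X w) -> cvg_in_distribution P X_ X.
Proof.
move=> Xm Xcvg; have XmX := borel_measurable_limit Xm Xcvg.
split=> // f cf [M [_ fM]]; rewrite unlock.
have fM1 u : `|f u| <= `|M| + 1 by apply: fM => //; rewrite (le_lt_trans (ler_norm _))// ltrDl.
have [] // := @dominated_convergence _ _ _ P setT measurableT
  (fun n w => (f (X_ n w))%:E) (fun w => (f (X w))%:E) (fun=> (`|M| + 1)%:E).
- by move=> n; apply/measurable_EFinP; exact: borel_measurable_comp.
- by apply/measurable_EFinP; exact: borel_measurable_comp.
- apply: aeW => w _; apply: cvg_EFin; first exact: nearW.
  exact: continuous_cvg (cf (X w)) (Xcvg w).
- exact: finite_measure_integrable_cst.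
- by apply: aeW => w n _; rewrite lee_fin.
Qed.

End Convergence.

(** * Classes of step functions *)

Section LinfClass.
Context {R : realType} {N : nat}.
Implicit Types f g : R -> 'cV[R]_N.

Lemma admissible_Linf f : admissible f -> Linf_fun f.
Proof.
move=> [fm [B fB]]; split => //.
apply: (@le_lt_trans _ _ B%:E); last exact: ltry.
by apply/ess_supP; apply: leb01_ae => t t01; rewrite lee_fin fB.
Qed.

Lemma Linf_class_dist f g c : admissible f -> admissible g ->
  (forall t, t \in `[0, 1] -> `|f t - g t| <= c) ->
  Linf_dist (Linf_class f) (Linf_class g) <= c.
Proof.
move=> fA gA fgc.
have c0 : 0 <= c by apply: le_trans (fgc 0 _); rewrite // bound_itvE.
rewrite -lee_fin /Linf_dist.
have le_c : (ess_sup (leb01 R) (fun t => `|linf_repr (Linf_class f) t -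
    linf_repr (Linf_class g) t|%:E) <= c%:E)%E.
  apply/ess_supP.
  have fgE := ae01S2 (fun t => @pair _ _) (Linf_classP (admissible_Linf fA))
    (Linf_classP (admissible_Linf gA)).
  apply: ae01S2 _ fgE (leb01_ae fgc) => t [ft gt] fgt.
  by rewrite lee_fin /linf_repr ft gt.
case: (ess_sup _ _) le_c => [r| |]//= _.
Qed.

End LinfClass.

Section ClassMeasurability.
Context {R : realType} {N : nat}.
Variables (s : seq R) (s_part : itv_partition 0 1 s).

(** In the non-separable space [L^oo], measurability at each time would not make a
    random function Borel measurable. A step function on a fixed partition depends
    continuously on its finitely many values, and that is enough. *)
Definition step_class (y : 'M[R]_(N, (size s).+1)) : Linf R N :=
  Linf_class (step s (fun j => col (inord j) y)).

Lemma step_class_continuous : continuous step_class.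
Proof.
move=> y U /nbhs_ballP[e /= e0 eU]; apply/nbhs_ballP; exists e => //= z yz.
apply: eU; move: yz; rewrite mx_norm_ball ballEmdist/=.
apply: le_lt_trans.
apply: Linf_class_dist => [||t _]; [exact: admissible_step..|].
apply: cV_norm_le => // i; rewrite !mxE.
by have := mx_entry_le (y - z) i (inord (index (rho s t) (knots s))); rewrite !mxE.
Qed.

Lemma step_classE (y : nat -> 'cV[R]_N) :
  Linf_class (step s y) = step_class (\matrix_(i, j) y j i ord0).
Proof.
apply: mdist_positivity; apply/le_anti; rewrite mdist_ge0 andbT.
apply: Linf_class_dist => [||t t01]; [exact: admissible_step..|].
rewrite /step (_ : col _ _ = y (index (rho s t) (knots s))) ?subrr ?normr0//.
apply/colP => i; rewrite !mxE inordK// ltnS.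
exact: index_rho_le.
Qed.

(** The class is a continuous function of the random matrix of the values. *)
Lemma borel_measurable_step (disp : measure_display) (T : measurableType disp)
    (y : T -> nat -> 'cV[R]_N) :
  (forall j i, measurable_fun setT (fun w => y w j i ord0)) ->
  borel_measurable (fun w => Linf_class (step s (y w))).
Proof.
move=> ym; apply/borel_measurableP => U oU.
under eq_fun do rewrite step_classE.
rewrite -[X in measurable X]/((fun w => \matrix_(i, j) y w j i ord0) @^-1` (step_class @^-1` U)).
apply: measurable_mx_open.
  by move=> i j; under eq_fun do rewrite mxE; exact: ym.
by move/continuousP : step_class_continuous; exact.
Qed.

End ClassMeasurability.

Lemma resnet_measurable (R : realType) (d N : nat) (phi : R -> R) (x : R -> 'cV[R]_d)
    (disp : measure_display) (T : measurableType disp)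
    (a : T -> 'cV[R]_N) (A : 'I_d -> T -> 'M[R]_N) (b : 'I_d -> T -> 'cV[R]_N)
    (t : nat -> R) : measurable_fun setT phi ->
  (forall j, measurable_fun [set: T] (weight a A b j)) ->
  forall j i, measurable_fun setT
    (fun w => resnet phi (a w) (A^~ w) (b^~ w) x t j i ord0).
Proof.
move=> phim wm; elim=> [|j IH] i /=; first exact: (wm (inl (inl i))).
under eq_fun do rewrite mxE summxE.
apply: measurable_funD; first exact: IH.
apply: measurable_sum => k; under eq_fun do rewrite !mxE.
apply: measurable_funM; first exact: measurable_cst.
apply: measurable_funD; last exact: (wm (inr (k, i))).
apply: measurable_sum => l; under eq_fun do rewrite mxE.
apply: measurable_funM; first exact: (wm (inl (inr (k, i, l)))).
exact: measurableT_comp (IH l).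
Qed.

(** * Convergence of the network *)

(** The pathwise statement: for fixed weights the network converges in [L^oo], at a
    rate given by the oscillation of the control over the mesh. *)
Lemma resnet_cvg (R : realType) (d N : nat) (phi : R -> R) (a : 'cV[R]_N)
    (A : 'I_d -> 'M[R]_N) (b : 'I_d -> 'cV[R]_N) (x v : R -> 'cV[R]_d)
    (D : nat -> seq R) :
  (forall M, itv_partition 0 1 (D M)) -> mesh (D M) @[M --> \oo] --> (0 : R) ->
  lipschitz (phi : R^o -> R^o) -> L2_derivative x v ->
  exists2 S, approximate_solution v (vector_field phi A b) a 0 S &
    Linf_class (resnet_path phi a A b x (D M)) @[M --> \oo] --> (Linf_class S : Linf R N).
Proof.
move=> D_part D_mesh phi_lip xv.
have vI := L2_derivative_integrable xv.
have [L WL] := vector_field_lipschitz A b phi_lip.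
have [B B0 approx] := resnet_approximate a vI xv WL.
pose delta M := B * control_oscillation v (mesh (D M)).
have delta0 : delta M @[M --> \oo] --> (0 : R).
  rewrite -(mulr0 B); apply: cvgM; first exact: cvg_cst.
  by apply: control_oscillation_cvg0 => // M; exact: mesh_ge0.
have ZA M : approximate_solution v (vector_field phi A b) a (delta M)
    (resnet_path phi a A b x (D M)).
  by apply: approx => // r t r0 rt t1 rtM; exact: control_oscillation_ge.
have [S S0] := approximate_solution_limit vI WL delta0 ZA.
exists S => //.
have [K K0 KP] := approximate_solution_stable a vI WL.
have Kdelta : K * delta M @[M --> \oo] --> (0 : R).
  by rewrite -(mulr0 K); apply: cvgM => //; exact: cvg_cst.
apply/cvg_ballP => e e0.
have [m _ mP] := cvgr_lt _ Kdelta _ e0.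
exists m => // M /= /mP/= KMe; apply: ball_sym; rewrite ballEmdist/=.
apply: le_lt_trans KMe; apply: Linf_class_dist => [||t t01].
- exact: (ZA M).1.
- exact: S0.1.
- by rewrite -[delta M]addr0; exact: KP (ZA M) S0 _ t01.
Qed.

(* There is no partition D_0 of [0,1], so [D M] stands for D_(M+1). *)
Theorem theorem4p3 (R : realType) (d N : nat) (N_ge1 : (1 <= N)%N)
    (sigma_a sigma_A sigma_b : R)
    (sigma_a_gt0 : 0 < sigma_a) (sigma_A_gt0 : 0 < sigma_A)
    (sigma_b_ge0 : 0 <= sigma_b)
    (D : nat -> seq R)
    (D_partition : forall M, itv_partition 0 1 (D M))
    (D_size : forall M, size (D M) = M.+1)
    (D_mesh : mesh (D M) @[M --> \oo] --> (0 : R))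
    (phi : R -> R) (phi_lipschitz : lipschitz (phi : R^o -> R^o))
    (phi_linearly_bounded : linearly_bounded phi)
    (x : R -> 'cV[R]_d) (x_path : path_space x)
    (disp : measure_display) (T : measurableType disp) (P : probability T R)
    (a : T -> 'cV[R]_N) (A : 'I_d -> T -> 'M[R]_N) (b : 'I_d -> T -> 'cV[R]_N)
    (weights : gaussian_weights P a A b sigma_a sigma_A sigma_b) :
  exists S : T -> R -> 'cV[R]_N,
    [/\ forall w, ncde_solution phi (a w) (A^~ w) (b^~ w) x (S w),
        forall w y, ncde_solution phi (a w) (A^~ w) (b^~ w) x y ->
          forall t, t \in `[0, 1] -> y t = S w t &
        cvg_in_distribution_Linf P
          (fun M w => resnet_path phi (a w) (A^~ w) (b^~ w) x (D M)) S].
Proof.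
have xv := dot_derivative x_path; have vI := L2_derivative_integrable xv.
have solP w y : ncde_solution phi (a w) (A^~ w) (b^~ w) x y <->
    approximate_solution (dot x) (vector_field phi (A^~ w) (b^~ w)) (a w) 0 y.
  have [L WL] := vector_field_lipschitz (A^~ w) (b^~ w) phi_lipschitz.
  exact: ncde_solutionP WL.
(* The solution is chosen for each outcome; its measurability is inherited from
   the networks in the limit. *)
have /choice[S SP] : forall w, exists S,
    approximate_solution (dot x) (vector_field phi (A^~ w) (b^~ w)) (a w) 0 S /\
    Linf_class (resnet_path phi (a w) (A^~ w) (b^~ w) x (D M)) @[M --> \oo] -->
      (Linf_class S : Linf R N).
  move=> w.
  have [S S0 Scvg] := resnet_cvg (a w) (A^~ w) (b^~ w) D_partition D_mesh phi_lipschitz xv.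
  by exists S.
have [weights_measurable _ _] := weights.
exists S; split.
- by move=> w; apply/solP; exact: (SP w).1.
- move=> w y /solP y0 t t01.
  have [L WL] := vector_field_lipschitz (A^~ w) (b^~ w) phi_lipschitz.
  have [K K0 KP] := approximate_solution_stable (a w) vI WL.
  have := KP _ _ _ _ y0 (SP w).1 t t01.
  by rewrite addr0 mulr0 normr_le0 subr_eq0 => /eqP.
split.
- move=> M w; apply: admissible_Linf.
  exact: (admissible_step (D_partition M)
    (resnet phi (a w) (A^~ w) (b^~ w) x (nth 0 (knots (D M))))).
- by move=> w; apply: admissible_Linf; exact: (SP w).1.1.
apply: cvg_in_distribution_pointwise => [M|w]; last exact: (SP w).2.
apply: (borel_measurable_step (D_partition M)
  (y := fun w => resnet phi (a w) (A^~ w) (b^~ w) x (nth 0 (knots (D M))))) => j i.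
exact: resnet_measurable (lipschitz_measurable phi_lipschitz) weights_measurable _ _.
Qed.
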